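(* Let $\mathcal{A} \in \mathbb{C}^{I_1\times\cdots\times I_M \times J_1\times\cdots\times J_N}$ and $\mathcal{B} \in \mathbb{C}^{J_1\times\cdots\times J_N \times K_1\times\cdots\times K_L}$. Let $\mathcal{M} \in \mathbb{C}^{I_1\times\cdots\times I_M \times I_1 \times\cdots\times I_M}$, $\mathcal{N} \in \mathbb{C}^{K_1\times\cdots\times K_L \times K_1 \times\cdots\times K_L}$ and $\mathcal{P} \in \mathbb{C}^{J_1\times\cdots\times J_N \times J_1 \times\cdots\times J_N}$ be three Hermitian positive definite tensors. Then $$(\mathcal{A}*_N\mathcal{B})_{\mathcal{M},\mathcal{N}} ^\dagger = \mathcal{B}_{\mathcal{P},\mathcal{N}}^\dagger *_N\mathcal{A}_{\mathcal{M},\mathcal{P}}^\dagger$$ if and only if $$\mathcal{A}_{\mathcal{M},\mathcal{P}}^\dagger *_M\mathcal{A}*_N\mathcal{B}*_L\mathcal{B}^{\#}_{\mathcal{N},\mathcal{P}}*_N\mathcal{A}^{\#}_{\mathcal{P},\mathcal{M}} = \mathcal{B}*_L\mathcal{B}^{\#}_{\mathcal{N},\mathcal{P}}*_N\mathcal{A}^{\#}_{\mathcal{P},\mathcal{M}}$$ and $$\mathcal{B}*_L\mathcal{B}_{\mathcal{P},\mathcal{N}}^\dagger *_N\mathcal{A}^{\#}_{\mathcal{P},\mathcal{M}}*_M\mathcal{A}*_N\mathcal{B} = \mathcal{A}^{\#}_{\mathcal{P},\mathcal{M}}*_M\mathcal{A}*_N\mathcal{B}.$$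
   Context: Einstein product: for $\mathcal{A}\in\mathbb{C}^{I_1\times\cdots\times I_M\times J_1\times\cdots\times J_N}$ and $\mathcal{B}\in\mathbb{C}^{J_1\times\cdots\times J_N\times K_1\times\cdots\times K_L}$, $(\mathcal{A}*_N\mathcal{B})_{i_1\ldots i_Mk_1\ldots k_L}=\sum_{j_1,\ldots,j_N}a_{i_1\ldots i_Mj_1\ldots j_N}b_{j_1\ldots j_Nk_1\ldots k_L}$ (the subscript is the number of contracted indices; similarly $*_M,*_L$). The conjugate transpose $\mathcal{A}^*$ has entries $(\mathcal{A}^* )_{j_1\ldots j_Ni_1\ldots i_M}=\overline{a_{i_1\ldots i_Mj_1\ldots j_N}}$. Inverses of tensors with the same row and column index sets are with respect to the Einstein product (identity tensors have entries equal to products of Kronecker deltas). A tensor $\mathcal{Q}$ with the same row and column index sets is Hermitian positive definite if $\mathcal{Q}=\mathcal{Z}*\mathcal{D}*\mathcal{Z}^*$ (Einstein products over all the row indices) with $\mathcal{Z}$ unitary ($\mathcal{Z}*\mathcal{Z}^*=\mathcal{Z}^**\mathcal{Z}$ is the identity tensor) and $\mathcal{D}$ a diagonal tensor with positive diagonal entries. Weighted Moore-Penrose inverse: for $\mathcal{A}\in\mathbb{C}^{I_1\times\cdots\times I_M\times J_1\times\cdots\times J_N}$ and Hermitian positive definite $\mathcal{M}$ (on $I_1\times\cdots\times I_M$) and $\mathcal{P}$ (on $J_1\times\cdots\times J_N$), $\mathcal{A}^\dagger_{\mathcal{M},\mathcal{P}}$ is the unique $\mathcal{Y}\in\mathbb{C}^{J_1\times\cdots\times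 J_N\times I_1\times\cdots\times I_M}$ with $\mathcal{A}*_N\mathcal{Y}*_M\mathcal{A}=\mathcal{A}$, $\mathcal{Y}*_M\mathcal{A}*_N\mathcal{Y}=\mathcal{Y}$, $(\mathcal{M}*_M\mathcal{A}*_N\mathcal{Y})^*=\mathcal{M}*_M\mathcal{A}*_N\mathcal{Y}$, $(\mathcal{P}*_N\mathcal{Y}*_M\mathcal{A})^*=\mathcal{P}*_N\mathcal{Y}*_M\mathcal{A}$; similarly for other index sets. Weighted conjugate transposes: $\mathcal{A}^{\#}_{\mathcal{P},\mathcal{M}}=\mathcal{P}^{-1}*_N\mathcal{A}^**_M\mathcal{M}$ and $\mathcal{B}^{\#}_{\mathcal{N},\mathcal{P}}=\mathcal{N}^{-1}*_L\mathcal{B}^**_N\mathcal{P}$. *)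

(* Defs.v *)
From HB Require Import structures.
From mathcomp Require Import all_boot all_order all_algebra.
From mathcomp Require Import boolp classical_sets reals.
From mathcomp Require Export complex.

Set Implicit Arguments.
Unset Strict Implicit.
Unset Printing Implicit Defensive.

Import Order.TTheory GRing.Theory Num.Theory.

Local Open Scope ring_scope.

Declare Scope tensor_scope.
Delimit Scope tensor_scope with T.

(* For the dimension vector I = (I_1, ..., I_m), the type of multi-indices
   (i_1, ..., i_m), each i_k ranging over {0, ..., I_k - 1}. *)
Definition midx (m : nat) (I : 'I_m -> nat) : finType :=
  {dffun forall k : 'I_m, 'I_(I k)}.

(* A complex tensor with row dimensions I and column dimensions J, i.e. an
   element of C^(I_1 x ... x I_m x J_1 x ... x J_n); the split of the indices
   into row and column groups is part of the type, so that the number of indices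
   contracted in a product is determined by the types of its factors. *)
Definition tensor (R : realType) (m n : nat)
    (I : 'I_m -> nat) (J : 'I_n -> nat) :=
  {ffun midx I * midx J -> R[i]}.

Definition einstein (R : realType) (m n l : nat)
    (I : 'I_m -> nat) (J : 'I_n -> nat) (K : 'I_l -> nat)
    (A : tensor R I J) (B : tensor R J K) : tensor R I K :=
  [ffun ik => \sum_(j : midx J) A (ik.1, j) * B (j, ik.2)].

Notation "A *t B" := (einstein A B)
  (at level 40, left associativity) : tensor_scope.

Local Open Scope tensor_scope.

Definition tadj (R : realType) (m n : nat)
    (I : 'I_m -> nat) (J : 'I_n -> nat) (A : tensor R I J) : tensor R J I :=
  [ffun ji => (A (ji.2, ji.1))^*].

(* [i == j] is the product over k of the Kronecker deltas of i_k and j_k. *)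
Definition tid (R : realType) (m : nat) (I : 'I_m -> nat) : tensor R I I :=
  [ffun ij => (ij.1 == ij.2)%:R].

Definition is_tinv (R : realType) (m : nat) (I : 'I_m -> nat)
    (Q X : tensor R I I) : Prop :=
  Q *t X = tid R I /\ X *t Q = tid R I.

(* The inverse for the Einstein product, with junk value 0 when Q is not
   invertible. *)
Definition tinv (R : realType) (m : nat) (I : 'I_m -> nat)
    (Q : tensor R I I) : tensor R I I :=
  xget (0 : {ffun midx I * midx I -> R[i]}) [set X | is_tinv Q X]%classic.

Definition tunitary (R : realType) (m : nat) (I : 'I_m -> nat)
    (Z : tensor R I I) : Prop :=
  Z *t tadj Z = tid R I /\ tadj Z *t Z = tid R I.

Definition tdiagonal (R : realType) (m : nat) (I : 'I_m -> nat)
    (D : tensor R I I) : Prop :=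
  forall i j : midx I, i != j -> D (i, j) = 0.

(* In R[i], [0 < z] means that z is real and positive. *)
Definition hermitian_posdef (R : realType) (m : nat) (I : 'I_m -> nat)
    (Q : tensor R I I) : Prop :=
  exists Z D : tensor R I I,
    [/\ tunitary Z, tdiagonal D, forall i : midx I, 0 < D (i, i)
      & Q = Z *t D *t tadj Z].

Definition is_wmpinv (R : realType) (m n : nat)
    (I : 'I_m -> nat) (J : 'I_n -> nat)
    (A : tensor R I J) (M : tensor R I I) (P : tensor R J J)
    (Y : tensor R J I) : Prop :=
  [/\ A *t Y *t A = A,
      Y *t A *t Y = Y,
      tadj (M *t A *t Y) = M *t A *t Y
    & tadj (P *t Y *t A) = P *t Y *t A].

(* The weighted Moore-Penrose inverse of A. For Hermitian positive definite
   M and P exactly one tensor satisfies [is_wmpinv A M P], and it is the value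
   selected here; the default 0 matters only for other weights. *)
Definition wmpinv (R : realType) (m n : nat)
    (I : 'I_m -> nat) (J : 'I_n -> nat)
    (A : tensor R I J) (M : tensor R I I) (P : tensor R J J) : tensor R J I :=
  xget (0 : {ffun midx J * midx I -> R[i]}) [set Y | is_wmpinv A M P Y]%classic.

(* The weights come in the order of the subscripts of A^#_{P,M}: first the one
   on the column indices of A, which is inverted, then the one on its row
   indices. This is the opposite of the order used by [wmpinv]. *)
Definition wadj (R : realType) (m n : nat)
    (I : 'I_m -> nat) (J : 'I_n -> nat)
    (A : tensor R I J) (P : tensor R J J) (M : tensor R I I) : tensor R J I :=
  tinv P *t tadj A *t M.

(* Main.v *)
(** [A^# = wadj A P M] is the adjoint of [A] for the inner products given by
    [M] and [P], and the weighted Moore-Penrose inverse is the ordinary one for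
    this proper involution: the two symmetry conditions say that [A Y] and
    [Y A] are self-adjoint.  It exists because every tensor has an inner
    inverse (by unfolding to a matrix) and [A^# A X = A^# A Y] forces
    [A X = A Y].  With [E = A^+ A] and [F = B B^+], Greville's conditions mean
    that [E] commutes with [B B^#] and [F] with [A^# A], which makes [B^+ A^+]
    satisfy the Penrose equations.  Conversely, the reverse order law yields
    [E F T = T] for [T = A^# A B], where [E T = T]; hence [T^# F T = T^# T], and
    since [F] is an orthogonal projector, [F T = T].  The other condition is
    the same statement for [B^#] and [A^#]. *)

From HB Require Import structures.
Require Import Defs.
From mathcomp Require Import all_boot all_order all_algebra.
From mathcomp Require Import reals complex.
From mathcomp Require Import boolp classical_sets.

Set Implicit Arguments.
Unset Strict Implicit.
Unset Printing Implicit Defensive.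

Import Order.TTheory GRing.Theory Num.Theory.

Local Open Scope ring_scope.
Local Open Scope tensor_scope.

(** * Algebra of the Einstein product and the conjugate transpose *)

Section EinsteinProduct.
Variables (R : realType) (m n : nat) (I : 'I_m -> nat) (J : 'I_n -> nat).

Lemma einsteinA l k (K : 'I_l -> nat) (L : 'I_k -> nat)
    (A : tensor R I J) (B : tensor R J K) (C : tensor R K L) :
  A *t (B *t C) = A *t B *t C.
Proof.
apply/ffunP => -[i j]; rewrite !ffunE /=.
under eq_bigr do rewrite ffunE mulr_sumr.
rewrite exchange_big; apply: eq_bigr => s _.
by rewrite ffunE mulr_suml; apply: eq_bigr => t _; rewrite mulrA.
Qed.

Lemma einstein1l (A : tensor R I J) : tid R I *t A = A.
Proof.
apply/ffunP => -[i j]; rewrite !ffunE /= (bigD1 i) //= ffunE eqxx mul1r.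
by rewrite big1 ?addr0 // => k /negPf ki; rewrite ffunE /= eq_sym ki mul0r.
Qed.

Lemma einstein1r (A : tensor R I J) : A *t tid R J = A.
Proof.
apply/ffunP => -[i j]; rewrite !ffunE /= (bigD1 j) //= ffunE eqxx mulr1.
by rewrite big1 ?addr0 // => k /negPf kj; rewrite ffunE /= kj mulr0.
Qed.

Lemma einstein0r l (K : 'I_l -> nat) (A : tensor R I J) :
  A *t (0 : tensor R J K) = 0.
Proof.
by apply/ffunP => i; rewrite !ffunE big1 // => j _; rewrite ffunE mulr0.
Qed.

Lemma einsteinBl l (K : 'I_l -> nat) (A B : tensor R I J) (C : tensor R J K) :
  (A - B : tensor R I J) *t C = A *t C - B *t C.
Proof.
apply/ffunP => i; rewrite !ffunE -sumrB.
by apply: eq_bigr => j _; rewrite !ffunE mulrBl.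
Qed.

Lemma einsteinBr l (K : 'I_l -> nat) (A : tensor R I J) (B C : tensor R J K) :
  A *t (B - C : tensor R J K) = A *t B - A *t C.
Proof.
apply/ffunP => i; rewrite !ffunE -sumrB.
by apply: eq_bigr => j _; rewrite !ffunE mulrBr.
Qed.

Lemma tadjK (A : tensor R I J) : tadj (tadj A) = A.
Proof. by apply/ffunP => -[i j]; rewrite !ffunE /= conjCK. Qed.

Lemma tadjB (A B : tensor R I J) :
  tadj (A - B : tensor R I J) = tadj A - tadj B.
Proof. by apply/ffunP => -[i j]; rewrite !ffunE rmorphB. Qed.

Lemma tadjM l (K : 'I_l -> nat) (A : tensor R I J) (B : tensor R J K) :
  tadj (A *t B) = tadj B *t tadj A.
Proof.
apply/ffunP => -[i j]; rewrite !ffunE rmorph_sum.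
by apply: eq_bigr => k _; rewrite !ffunE rmorphM mulrC.
Qed.

Lemma tadj1 : tadj (tid R I) = tid R I.
Proof. by apply/ffunP => -[i j]; rewrite !ffunE rmorph_nat eq_sym. Qed.

(** Enumerating the multi-indices turns [A] into a matrix [a], for which
    [a *m pinvmx a *m a = a]. *)
Lemma einstein_inner_inverse (A : tensor R I J) :
  exists X : tensor R J I, A *t X *t A = A.
Proof.
pose a := \matrix_(i < #|midx I|, j < #|midx J|) A (enum_val i, enum_val j).
exists [ffun ji => pinvmx a (enum_rank ji.1) (enum_rank ji.2)].
apply/ffunP => -[i j]; rewrite !ffunE /=.
have /matrixP/(_ (enum_rank i) (enum_rank j)) := mulmxKpV (submx_refl a).
rewrite !mxE !enum_rankK => <-.
rewrite (reindex_onto enum_rank enum_val) => [|k _]; last by rewrite enum_valK.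
apply: eq_big => [k|k _]; first by rewrite enum_rankK eqxx.
rewrite !ffunE !mxE /= !enum_rankK; congr (_ * _).
rewrite [RHS](reindex_onto enum_rank enum_val) => [|s _]; last first.
  by rewrite enum_valK.
apply: eq_big => [s|s _]; first by rewrite enum_rankK eqxx.
by rewrite !ffunE !mxE !enum_rankK.
Qed.

End EinsteinProduct.

(** In a left-nested product, [U *t V] is not a subterm of [X *t U *t V]; this form allows rewriting
    with an identity for it there. *)
Lemma einstein_subst2 (R : realType) m n k l (I : 'I_m -> nat)
    (J : 'I_n -> nat) (K : 'I_k -> nat) (L : 'I_l -> nat)
    (U : tensor R J K) (V : tensor R K L) (W : tensor R J L) :
  U *t V = W -> forall X : tensor R I J, X *t U *t V = X *t W.
Proof. by move=> <- X; rewrite einsteinA. Qed.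

(** * Hermitian positive definite tensors *)

Section PositiveDefinite.
Variables (R : realType) (m : nat) (I : 'I_m -> nat).
Implicit Types Q D X : tensor R I I.

Lemma tdiagonal_einstein n (J : 'I_n -> nat) D (A : tensor R I J) i j :
  tdiagonal D -> (D *t A) (i, j) = D (i, i) * A (i, j).
Proof.
move=> dD; rewrite ffunE /= (bigD1 i) //= big1 ?addr0 // => k ki.
by rewrite dD ?mul0r // eq_sym.
Qed.

Lemma is_tinv_unique Q X Y : is_tinv Q X -> is_tinv Q Y -> X = Y.
Proof.
by case=> _ XQ [QY _]; rewrite -[X]einstein1r -QY einsteinA XQ einstein1l.
Qed.

Lemma posdef_inverse Q : hermitian_posdef Q -> exists X, is_tinv Q X.
Proof.
case=> Z [D [[ZZ' Z'Z] dD D_gt0 ->]].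
(* [D'] inverts [D] entrywise on the diagonal; the inverse of [Q] is then [Z *t D' *t tadj Z]. *)
pose D' : tensor R I I := [ffun ij => (D ij)^-1 *+ (ij.1 == ij.2)].
have dD' : tdiagonal D' by move=> i j /negPf ij; rewrite ffunE /= ij.
have D_neq0 i : D (i, i) != 0 by rewrite gt_eqF.
have DD' : D *t D' = tid R I.
  apply/ffunP => -[i j]; rewrite tdiagonal_einstein // !ffunE /=.
  by have [->|_] := eqVneq i j; rewrite ?mulfV ?mulr0.
have D'D : D' *t D = tid R I.
  apply/ffunP => -[i j]; rewrite tdiagonal_einstein // !ffunE /= eqxx mulr1n.
  by have [->|ij] := eqVneq i j; rewrite ?mulVf // (dD _ _ ij) mulr0.
exists (Z *t D' *t tadj Z); split; rewrite !einsteinA.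
  by rewrite (einstein_subst2 Z'Z) einstein1r (einstein_subst2 DD') einstein1r.
by rewrite (einstein_subst2 Z'Z) einstein1r (einstein_subst2 D'D) einstein1r.
Qed.

Lemma tinvP Q : hermitian_posdef Q -> is_tinv Q (tinv Q).
Proof. by move=> /posdef_inverse; exact: xgetPex. Qed.

Lemma tadj_posdef Q : hermitian_posdef Q -> tadj Q = Q.
Proof.
case=> Z [D [_ dD D_gt0 ->]]; rewrite !tadjM tadjK einsteinA.
congr (_ *t _ *t _); apply/ffunP => -[i j]; rewrite ffunE /=.
have [<-|ij] := eqVneq i j; first by rewrite conj_Creal // gtr0_real.
by rewrite !dD ?conjC0 // eq_sym.
Qed.

Lemma tadj_tinv Q : hermitian_posdef Q -> tadj (tinv Q) = tinv Q.
Proof.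
move=> hQ; have [QV VQ] := tinvP hQ; apply: (is_tinv_unique _ (tinvP hQ)).
split; rewrite -[RHS]tadj1; first by rewrite -[in RHS]VQ tadjM (tadj_posdef hQ).
by rewrite -[in RHS]QV tadjM (tadj_posdef hQ).
Qed.

(** With [W = tadj Z *t A], the diagonal entries of the form are sums of terms [D_ii |W_ij|^2] with
    [D_ii > 0], so they vanish only if [W] does. *)
Lemma posdef_form_eq0 n (J : 'I_n -> nat) Q (A : tensor R I J) :
  hermitian_posdef Q -> tadj A *t Q *t A = 0 -> A = 0.
Proof.
case=> Z [D [[ZZ' _] dD D_gt0 ->]] AQA0.
suff W0 : tadj Z *t A = 0.
  by rewrite -[A]einstein1l -ZZ' -einsteinA W0 einstein0r.
have : tadj (tadj Z *t A) *t (D *t (tadj Z *t A)) = 0.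
  by rewrite tadjM tadjK !einsteinA in AQA0 *.
move: (tadj Z *t A) => W WDW0; apply/ffunP => -[i j]; rewrite ffunE.
have /ffunP/(_ (j, j)) := WDW0; rewrite !ffunE /=.
under eq_bigr do rewrite tdiagonal_einstein // ffunE mulrCA [_^* * _]mulrC.
move=> /eqP; rewrite psumr_eq0 => [/allP/(_ i (mem_index_enum i))|k _].
  by rewrite /= mulf_eq0 mul_conjC_eq0 gt_eqF //= => /eqP.
by rewrite mulr_ge0 ?mul_conjC_ge0 // ltW.
Qed.

End PositiveDefinite.

(* Locked, since [einsteinA] would otherwise rewrite inside [wadj]. *)
HB.lock Definition wadjoint (R : realType) (m n : nat)
    (I : 'I_m -> nat) (J : 'I_n -> nat)
    (A : tensor R I J) (P : tensor R J J) (M : tensor R I I) : tensor R J I :=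
  wadj A P M.

Lemma wadj_lock (R : realType) (m n : nat) (I : 'I_m -> nat) (J : 'I_n -> nat)
    (A : tensor R I J) (P : tensor R J J) (M : tensor R I I) :
  wadj A P M = wadjoint A P M.
Proof. by rewrite wadjoint.unlock. Qed.

(** * The weighted adjoint as a proper involution *)

Section WeightedAdjoint.
Variables (R : realType) (m n : nat) (I : 'I_m -> nat) (J : 'I_n -> nat).
Variables (M : tensor R I I) (P : tensor R J J).
Hypotheses (hM : hermitian_posdef M) (hP : hermitian_posdef P).

Lemma wadjK (A : tensor R I J) : wadjoint (wadjoint A P M) M P = A.
Proof.
have [_ MK] := tinvP hM; have [_ PK] := tinvP hP.
rewrite !wadjoint.unlock /wadj !tadjM tadjK (tadj_posdef hM) (tadj_tinv hP).
by rewrite !einsteinA MK einstein1l (einstein_subst2 PK) einstein1r.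
Qed.

Lemma wadjB (A B : tensor R I J) :
  wadjoint (A - B : tensor R I J) P M = wadjoint A P M - wadjoint B P M.
Proof. by rewrite !wadjoint.unlock /wadj tadjB einsteinBr einsteinBl. Qed.

(** The inner weights meet as [P *t tinv P] and cancel. *)
Lemma wadjM l (K : 'I_l -> nat) (N : tensor R K K)
    (A : tensor R I J) (B : tensor R J K) :
  wadjoint (A *t B) N M = wadjoint B N P *t wadjoint A P M.
Proof.
have [PK _] := tinvP hP.
rewrite !wadjoint.unlock /wadj tadjM !einsteinA.
by rewrite (einstein_subst2 PK) einstein1r.
Qed.

(** Multiplying [A^# A] by [P] on the left gives the form [tadj A *t M *t A], and [M] is
    definite. *)
Lemma wadj_einstein_eq0 (A : tensor R I J) : wadjoint A P M *t A = 0 -> A = 0.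
Proof.
have [PK _] := tinvP hP.
rewrite wadjoint.unlock => AA0; apply: (posdef_form_eq0 hM).
rewrite -[tadj A]einstein1l -PK.
rewrite -!einsteinA [X in _ *t X]einsteinA [X in _ *t X]einsteinA AA0.
exact: einstein0r.
Qed.

(** As [M] is Hermitian, [X^#] is [tinv M *t tadj (M *t X)]. *)
Lemma hermitian_wadj (X : tensor R I I) :
  tadj (M *t X) = M *t X <-> wadjoint X M M = X.
Proof.
have [MV VM] := tinvP hM.
rewrite !wadjoint.unlock /wadj tadjM (tadj_posdef hM) -einsteinA.
split=> [->|XE]; first by rewrite einsteinA VM einstein1l.
by rewrite -[in RHS]XE einsteinA MV einstein1l.
Qed.

End WeightedAdjoint.

(** * Penrose equations through the weighted adjoint, and uniqueness *)

Section WeightedMoorePenrose.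
Variables (R : realType) (m n : nat) (I : 'I_m -> nat) (J : 'I_n -> nat).
Variables (M : tensor R I I) (P : tensor R J J).
Hypotheses (hM : hermitian_posdef M) (hP : hermitian_posdef P).
Implicit Types (A : tensor R I J) (Y : tensor R J I).

(** For [D = X - Y], [(A D)^# (A D) = D^# (A^# A D) = 0], so [A D = 0]. *)
Lemma wadj_cancel l (K : 'I_l -> nat) (N : tensor R K K) A
    (X Y : tensor R J K) :
  hermitian_posdef N ->
  wadjoint A P M *t A *t X = wadjoint A P M *t A *t Y -> A *t X = A *t Y.
Proof.
move=> hN AAXY; apply: subr0_eq; rewrite -einsteinBr.
apply: (wadj_einstein_eq0 hM hN); rewrite (wadjM _ hP) -einsteinA.
by rewrite [X in _ *t X]einsteinA einsteinBr AAXY subrr einstein0r.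
Qed.

(** The adjoints of [A Y] and [Y A] are kept expanded as products, the shape in which later proofs
    rewrite with them. *)
Lemma is_wmpinvE A Y :
  is_wmpinv A M P Y <->
  [/\ A *t Y *t A = A, Y *t A *t Y = Y,
      wadjoint Y M P *t wadjoint A P M = A *t Y
    & wadjoint A P M *t wadjoint Y M P = Y *t A].
Proof.
rewrite -(wadjM _ hP) -(wadjM _ hM).
rewrite /is_wmpinv -[in M *t A *t Y]einsteinA -[in P *t Y *t A]einsteinA.
by split=> -[AYA YAY AY YA]; split=> //; apply/hermitian_wadj.
Qed.

Lemma is_wmpinv_unique A X Y :
  is_wmpinv A M P X -> is_wmpinv A M P Y -> X = Y.
Proof.
move=> /is_wmpinvE[AXA XAX AX XA] /is_wmpinvE[AYA YAY AY YA].
have A'Y'A' :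
    wadjoint A P M *t wadjoint Y M P *t wadjoint A P M = wadjoint A P M.
  by rewrite -(wadjM _ hM) -(wadjM _ hP) einsteinA AYA.
(* [A X = X^# A^# = X^# A^# Y^# A^# = A X A Y = A Y]; the next identity is dual. *)
have AXY : A *t X = A *t Y.
  by rewrite -AX -A'Y'A' -!einsteinA AY [LHS]einsteinA AX !einsteinA AXA.
have XYA : X *t A = Y *t A.
  by rewrite -XA -A'Y'A' -einsteinA XA YA -!einsteinA [A *t _]einsteinA AXA.
by rewrite -XAX XYA -einsteinA AXY einsteinA YAY.
Qed.

Lemma wadj_inverse13 A :
  exists G, A *t G *t A = A /\ wadjoint G M P *t wadjoint A P M = A *t G.
Proof.
have [X AAXAA] := einstein_inner_inverse (wadjoint A P M *t A).
have AXA : A *t (X *t wadjoint A P M *t A) = A.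
  rewrite -[RHS]einstein1r; apply: (wadj_cancel hP).
  by rewrite einstein1r !einsteinA in AAXAA *.
(* Symmetry comes from [A^# = A^# A X^# A^#], which gives
   [A X A^# = A X A^# A X^# A^# = A X^# A^#]. *)
exists (X *t wadjoint A P M); split; first by rewrite -einsteinA.
have := congr1 (fun T => wadjoint T P M) AXA.
rewrite !(wadjM _ hP, wadjM _ hM) !wadjK // => A'X'A.
by rewrite -[in RHS]A'X'A; rewrite !einsteinA in AXA *; rewrite AXA.
Qed.

End WeightedMoorePenrose.

(** * Existence of the weighted inverse, and its adjoint *)

Section WeightedMoorePenroseInverse.
Variables (R : realType) (m n : nat) (I : 'I_m -> nat) (J : 'I_n -> nat).
Variables (M : tensor R I I) (P : tensor R J J).
Hypotheses (hM : hermitian_posdef M) (hP : hermitian_posdef P).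
Implicit Types (A : tensor R I J) (Y : tensor R J I).

Lemma wmpinv_exists A : exists Y, is_wmpinv A M P Y.
Proof.
have [G [AGA AG]] := wadj_inverse13 hM hP A.
have [H [A'HA' HA]] := wadj_inverse13 hP hM (wadjoint A P M).
have {A'HA'} := congr1 (fun T => wadjoint T M P) A'HA'.
rewrite !(wadjM _ hP, wadjM _ hM) !wadjK // in HA *.
move: (wadjK hM hP H) HA; move: (wadjoint H P M) => H' H'K HA AHA.
have AY : A *t (H' *t A *t G) = A *t G.
  by rewrite !einsteinA in AHA *; rewrite AHA.
have YA : H' *t A *t G *t A = H' *t A.
  by rewrite -!einsteinA in AGA *; rewrite AGA.
(* Urquhart's formula: [G] is an inner inverse with [A G] self-adjoint, and [H' = H^#] is one with
   [H' A] self-adjoint. *)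
exists (H' *t A *t G); apply/is_wmpinvE => //; split.
- by rewrite AY.
- by rewrite YA -einsteinA AY einsteinA.
- by rewrite -(wadjM _ hP) AY (wadjM _ hP).
- by rewrite -(wadjM _ hM) YA (wadjM _ hM) H'K HA.
Qed.

Lemma wmpinvP A : is_wmpinv A M P (wmpinv A M P).
Proof. exact: xgetPex (wmpinv_exists A). Qed.

Lemma wmpinv_eqP A Y : wmpinv A M P = Y <-> is_wmpinv A M P Y.
Proof.
split=> [<-|AY]; first exact: wmpinvP.
exact: is_wmpinv_unique (wmpinvP A) AY.
Qed.

Lemma is_wmpinv_wadj A Y :
  is_wmpinv A M P Y -> is_wmpinv (wadjoint A P M) P M (wadjoint Y M P).
Proof.
move=> /(is_wmpinvE hM hP)[AYA YAY AY YA]; apply/is_wmpinvE => //.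
rewrite !wadjK // AY YA; split=> //.
- by rewrite -YA -(wadjM _ hM) -(wadjM _ hP) einsteinA AYA.
- by rewrite -AY -(wadjM _ hP) -(wadjM _ hM) einsteinA YAY.
Qed.

End WeightedMoorePenroseInverse.

(** * Self-adjoint tensors and projectors *)

Section SelfAdjoint.
Variables (R : realType) (n : nat) (J : 'I_n -> nat) (P : tensor R J J).
Hypothesis hP : hermitian_posdef P.
Variables E F : tensor R J J.
Hypotheses (saE : wadjoint E P P = E) (saF : wadjoint F P P = F).

(** [E F E] is self-adjoint, so taking adjoints in the hypothesis gives [E F E = E F]. *)
Lemma selfadjoint_commute : E *t F *t E = F *t E -> F *t E = E *t F.
Proof.
move=> EFE; have := congr1 (fun T => wadjoint T P P) EFE.
by rewrite !(wadjM _ hP) saE saF einsteinA EFE.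
Qed.

Lemma projector_fix l (K : 'I_l -> nat) (N : tensor R K K) (T : tensor R J K) :
    hermitian_posdef N -> F *t F = F -> E *t T = T -> E *t F *t T = T ->
  F *t T = T.
Proof.
move=> hN FF ET EFT; set Ts := wadjoint T N P.
have TE : Ts *t E = Ts by rewrite -saE -(wadjM _ hP) ET.
have TFT : Ts *t F *t T = Ts *t T.
  by rewrite -TE -!einsteinA [E *t (F *t _)]einsteinA EFT ET.
(* In the expansion of [(F T - T)^# (F T - T)] all four terms are [T^# T] up to sign, and they
   cancel. *)
apply/subr0_eq/(wadj_einstein_eq0 hP hN).
rewrite wadjB (wadjM _ hP) saF -/Ts einsteinBl !einsteinBr !einsteinA.
by rewrite (einstein_subst2 FF) TFT !subrr.
Qed.

End SelfAdjoint.

(** * Greville's conditions and the reverse order law *)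

Section ReverseOrderLaw.
Variables (R : realType) (m n l : nat).
Variables (I : 'I_m -> nat) (J : 'I_n -> nat) (K : 'I_l -> nat).
Variables (M : tensor R I I) (N : tensor R K K) (P : tensor R J J).
Hypotheses (hM : hermitian_posdef M) (hN : hermitian_posdef N).
Hypothesis hP : hermitian_posdef P.
Variables (A : tensor R I J) (a : tensor R J I).
Variables (B : tensor R J K) (b : tensor R K J).
Hypotheses (hA : is_wmpinv A M P a) (hB : is_wmpinv B P N b).

Local Notation As := (wadjoint A P M).
Local Notation Bs := (wadjoint B N P).

Lemma greville_sufficient :
    a *t A *t B *t Bs *t As = B *t Bs *t As ->
    B *t b *t As *t A *t B = As *t A *t B ->
  is_wmpinv (A *t B) M N (b *t a).
Proof.
have [AaA aAa Aa aA] := (is_wmpinvE hM hP A a).1 hA.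
have [BbB bBb Bb bB] := (is_wmpinvE hP hN B b).1 hB.
have [A'aA' _ _ _] := (is_wmpinvE hP hM _ _).1 (is_wmpinv_wadj hM hP hA).
have [B'bB' _ _ _] := (is_wmpinvE hN hP _ _).1 (is_wmpinv_wadj hP hN hB).
move=> cAB cBA.
have saE : wadjoint (a *t A) P P = a *t A by rewrite (wadjM _ hM).
have saF : wadjoint (B *t b) P P = B *t b by rewrite (wadjM _ hN).
have saBB : wadjoint (B *t Bs) P P = B *t Bs by rewrite (wadjM _ hN) wadjK.
have saAA : wadjoint (As *t A) P P = As *t A by rewrite (wadjM _ hM) wadjK.
have EBB : B *t Bs *t (a *t A) = a *t A *t (B *t Bs).
  apply: (selfadjoint_commute hP saE saBB).
  (* Right multiplication by [a^#] turns the final [A^#] into [A^# a^# = a A]. *)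
  have := congr1 (fun T => T *t wadjoint a M P) cAB.
  by rewrite -!einsteinA aA.
have FAA : As *t A *t (B *t b) = B *t b *t (As *t A).
  apply: (selfadjoint_commute hP saF saAA).
  by rewrite !einsteinA cBA.
have FE : a *t A *t (B *t b) = B *t b *t (a *t A).
  apply: (selfadjoint_commute hP saF saE).
  (* With [E = a A] and [F = B b], [E F = E B B^# b^# b = B B^# E b^# b] begins with [B], hence
     [F E F = E F]. *)
  have FBB : B *t b = B *t Bs *t (wadjoint b P N *t b).
    by rewrite !einsteinA (einstein_subst2 bB) einsteinA BbB.
  have EF : a *t A *t (B *t b) = B *t Bs *t (a *t A) *t (wadjoint b P N *t b).
    by rewrite EBB FBB !einsteinA.
  by rewrite -einsteinA EF !einsteinA BbB.
apply/is_wmpinvE => //; rewrite !(wadjM _ hP); split.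
- have := congr1 (fun T => A *t T *t B) FE; rewrite !einsteinA => <-.
  by rewrite AaA -2!einsteinA [X in _ *t X]einsteinA BbB.
- have := congr1 (fun T => b *t T *t a) FE; rewrite !einsteinA => ->.
  by rewrite bBb -2!einsteinA [X in _ *t X]einsteinA aAa.
(* The left side becomes [a^# F A^# = a^# F A^# A a]; moving [F] past [A^# A] leaves [A F a]. *)
- rewrite einsteinA (einstein_subst2 Bb).
  have -> : As = As *t A *t a by rewrite -einsteinA -Aa einsteinA.
  have := congr1 (fun T => wadjoint a M P *t T *t a) FAA.
  by rewrite !einsteinA => <-; rewrite Aa AaA.
(* Dually, [B^# E b^# = b B B^# E b^# = b E B B^# b^# = b E B]. *)
- rewrite einsteinA (einstein_subst2 aA).
  have -> : Bs = b *t B *t Bs by rewrite -bB.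
  have := congr1 (fun T => b *t T *t wadjoint b P N) EBB.
  rewrite !einsteinA => ->; rewrite (einstein_subst2 bB) einsteinA.
  by rewrite -2!einsteinA [X in _ *t X]einsteinA BbB.
Qed.

Lemma greville_necessary :
    is_wmpinv (A *t B) M N (b *t a) ->
  B *t b *t As *t A *t B = As *t A *t B.
Proof.
have [_ _ _ aA] := (is_wmpinvE hM hP A a).1 hA.
have [BbB _ Bb _] := (is_wmpinvE hP hN B b).1 hB.
have [A'aA' _ _ _] := (is_wmpinvE hP hM _ _).1 (is_wmpinv_wadj hM hP hA).
move=> /(is_wmpinvE hM hN)[CcC _ Cc _].
have saE : wadjoint (a *t A) P P = a *t A by rewrite (wadjM _ hM).
have saF : wadjoint (B *t b) P P = B *t b by rewrite (wadjM _ hN).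
have FF : B *t b *t (B *t b) = B *t b by rewrite einsteinA BbB.
have ET : a *t A *t (As *t (A *t B)) = As *t (A *t B).
  by rewrite -aA !einsteinA A'aA'.
rewrite -[RHS]einsteinA -[in LHS]einsteinA -[LHS]einsteinA.
apply: (projector_fix hP saE saF hN FF ET).
(* On the right, [A B] becomes [(b a)^# (A B)^# A B], in which [b^# B^#] is [B b]. *)
rewrite -aA -[in RHS]CcC -Cc (wadjM _ hP) (wadjM _ hP) !einsteinA.
have := congr1 (fun T => As *t wadjoint a M P *t T *t As *t A *t B) Bb.
by rewrite !einsteinA => ->.
Qed.

End ReverseOrderLaw.

Theorem corollary5 (R : realType) (m n l : nat)
    (I : 'I_m -> nat) (J : 'I_n -> nat) (K : 'I_l -> nat)
    (A : tensor R I J) (B : tensor R J K)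
    (M : tensor R I I) (N : tensor R K K) (P : tensor R J J)
    (hM : hermitian_posdef M) (hN : hermitian_posdef N)
    (hP : hermitian_posdef P) :
  wmpinv (A *t B) M N = wmpinv B P N *t wmpinv A M P
  <->
  wmpinv A M P *t A *t B *t wadj B N P *t wadj A P M
    = B *t wadj B N P *t wadj A P M
  /\
  B *t wmpinv B P N *t wadj A P M *t A *t B
    = wadj A P M *t A *t B.
Proof.
have hA := wmpinvP hM hP A; have [_ _ _ aA] := (is_wmpinvE hM hP _ _).1 hA.
have hB := wmpinvP hP hN B.
rewrite !wadj_lock; apply: (iff_trans (wmpinv_eqP hM hN _ _)).
split=> [hAB|[]]; last exact: greville_sufficient.
split; last exact: (greville_necessary hM hN hP hA hB).
(* [(A B)^# = B^# A^#] has inverse [a^# b^#], so the necessary condition for the pair [B^#], [A^#]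
   is the first equation. *)
have := is_wmpinv_wadj hM hN hAB; rewrite !(wadjM _ hP).
move/(greville_necessary hN hM hP (is_wmpinv_wadj hP hN hB)
  (is_wmpinv_wadj hM hP hA)).
by rewrite !wadjK // aA.
Qed.
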